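(* Let $n\ge2$. If $\mathcal{L}$ is an arbitrary polynomial pencil in $\mathcal{H}_n$ (i.e. a polynomial pencil in $\mathcal{R}_n$ contained in $\mathcal{H}_n$) and $T\in\mathcal{A}_n(\mathbb{R})$, then the restriction to $\mathcal{L}$ of the $T$-twisted span function, $\Delta\circ T|_{\mathcal{L}}$, is convex and has a global minimum.
   Context: $\mathcal{R}_n$ is the set of monic real polynomials of degree $n$ and $\mathcal{H}_n\subset\mathcal{R}_n$ the subset of those with only real zeros. $\mathcal{A}_n(\mathbb{R})$ is the set of linear maps $T:\mathbb{C}[x]\to\mathbb{C}[x]$ with $T(\mathcal{H}_n)\subseteq\mathcal{H}_n$. For $P\in\mathcal{H}_n$ the span is $\Delta(P)=\max\mathcal{Z}(P)-\min\mathcal{Z}(P)$, where $\mathcal{Z}(P)$ is the collection of zeros of $P$; the $T$-twisted span function on $\mathcal{H}_n$ is $\Delta\circ T$. A polynomial pencil in $\mathcal{R}_n$ is a real line $\{(1-\lambda)P_1+\lambda P_2\mid\lambda\in\mathbb{R}\}$ through two distinct $P_1,P_2\in\mathcal{R}_n$. *)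

(* Defs.v *)
From HB Require Import structures.
From mathcomp Require Import all_boot all_order all_algebra.
From mathcomp Require Import all_classical reals interval_inference convex.
From mathcomp Require Export complex.

Set Implicit Arguments.
Unset Strict Implicit.
Unset Printing Implicit Defensive.

Import Order.TTheory GRing.Theory Num.Theory.
Local Open Scope classical_set_scope.
Local Open Scope ring_scope.
Local Open Scope complex_scope.

Definition complexify (R : realType) (p : {poly R}) : {poly R[i]} :=
  map_poly (real_complex R) p.

Definition zeros (R : realType) (q : {poly R[i]}) : set R[i] :=
  [set z | root q z].

(* [size p] is the degree plus one. *)
Definition monic_deg (R : realType) (n : nat) : set {poly R} :=
  [set p | p \is monic /\ size p = n.+1].

Definition hyperbolic (R : realType) (n : nat) : set {poly R} :=
  [set p | monic_deg n p /\
           forall z : R[i], zeros (complexify p) z -> z \is Num.real].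

Definition preserves_hyperbolic (R : realType) (n : nat)
    (T : {linear {poly R[i]} -> {poly R[i]}}) : Prop :=
  T @` (@complexify R @` hyperbolic n) `<=` @complexify R @` hyperbolic n.

(* Meaningful for a nonconstant polynomial all of whose zeros are real: the
   zeros are then identified with their real parts, and the supremum and
   infimum of this nonempty finite set are its maximum and minimum; see
   [span_max_min]. *)
Definition span (R : realType) (q : {poly R[i]}) : R :=
  sup (@complex.Re R @` zeros q) - inf (@complex.Re R @` zeros q).

Definition twisted_span (R : realType)
    (T : {linear {poly R[i]} -> {poly R[i]}}) (p : {poly R}) : R :=
  span (T (complexify p)).

Definition is_pencil (R : realType) (n : nat) (L : set {poly R}) : Prop :=
  exists P1 P2 : {poly R},
    [/\ monic_deg n P1, monic_deg n P2, P1 <> P2 &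
        L = [set (1 - l) *: P1 + l *: P2 | l in [set: R]]].

Lemma span_max_min (R : realType) (n : nat) (p : {poly R}) :
  (0 < n)%N -> hyperbolic n p ->
  exists x y : R, [/\ zeros (complexify p) x%:C, zeros (complexify p) y%:C,
    forall z : R, zeros (complexify p) z%:C -> x <= z <= y &
    span (complexify p) = y - x].
Proof.
move=> n0 [[_ sp] rp].
have szp : size (complexify p) = n.+1 by rewrite size_map_poly.
have p0 : complexify p != 0 by rewrite -size_poly_eq0 szp.
have [rs pE] := closed_field_poly_normal (complexify p).
have zE z : zeros (complexify p) z <-> z \in rs.
  rewrite /zeros /= pE rootZ ?root_prod_XsubC //.
  by rewrite lead_coef_eq0.
have rsn : rs != [::].
  apply/eqP => rs0; move: szp; rewrite pE rs0 big_nil alg_polyC size_polyC.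
  by case: (_ != 0) n0; case: (n).
set S := @complex.Re R @` zeros (complexify p).
have SE x : S x <-> zeros (complexify p) x%:C.
  split=> [[z zz <-]|zx]; first by rewrite (RRe_real (rp z zz)).
  by exists x%:C.
have SF x : S x <-> x \in [seq complex.Re z | z <- rs].
  split=> [[z /zE zz <-]|/mapP[z zr ->]]; first exact: map_f.
  by exists z => //; apply/zE.
pose t := sort <=%O [seq complex.Re z | z <- rs].
have tS x : x \in t <-> S x by rewrite mem_sort; split=> /SF.
have ts : sorted <=%O t by apply: sort_le_sorted.
case tE : t => [|x s].
  by move: rsn; rewrite -size_eq0 -(size_map (@complex.Re R)) -(size_sort <=%O) -/t tE.
have Sx : S x by apply/tS; rewrite tE mem_head.
have Sy : S (last x s) by apply/tS; rewrite tE mem_last.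
have lex z : S z -> x <= z.
  move/tS; rewrite tE inE => /predU1P[->//|zs].
  by move: ts; rewrite tE /= (path_sortedE le_trans) => /andP[/allP/(_ z zs)].
have ley z : S z -> z <= last x s.
  move/tS; rewrite tE => zs.
  have := ts; rewrite tE => st.
  have i1 : (index z (x :: s) < size (x :: s))%N by rewrite index_mem.
  rewrite -(nth_index x zs) (last_nth x).
  have := @sorted_leq_nth _ _ (@le_trans _ R) (@lexx _ R) x _ st.
  by apply; rewrite ?inE //=.
exists x, (last x s); split; [exact/SE|exact/SE| |].
  by move=> z /SE Sz; rewrite lex ?ley.
rewrite /span -/S; congr (_ - _); apply/eqP; rewrite eq_le; apply/andP; split.
- by apply: ge_sup => //; exists x.
- by apply: ub_le_sup => //; exists (last x s).
- by apply: ge_inf => //; exists x.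
- by apply: lb_le_inf => //; exists x.
Qed.

(* Main.v *)
(* T maps the pencil to a line f + l q of monic real-rooted polynomials.  If
   f = prod_i (X - r_i), real-rootedness of the whole line forces
   q = sum_i c_i prod_(j != i) (X - r_j) with all c_i of one sign: common roots
   are divided out, the remaining r_i are then simple, and two c_i of opposite
   signs would yield, by the intermediate value theorem on a line Im z = d close
   to the real axis, a nonreal z at which q / f is real.
   With such a decomposition the largest root at parameter t is at least
   r_max - t c_max, a supporting line; the smallest root is treated by
   reflection, so the span has a subgradient everywhere.  Since sum_i c_i <> 0
   when q <> 0, the mean of the roots is a nonconstant affine function of the
   parameter, while on each side one extremal root stays bounded; so the span is
   coercive and attains its minimum. *)
Require Import Defs.
From mathcomp Require Import all_boot all_order all_algebra.
From mathcomp Require Import all_classical reals interval_inference convex.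
From mathcomp Require Import ring lra polyrcf.

Set Implicit Arguments.
Unset Strict Implicit.
Unset Printing Implicit Defensive.

Import Order.TTheory GRing.Theory Num.Theory.
Local Open Scope classical_set_scope.
Local Open Scope ring_scope.
Local Open Scope complex_scope.

Definition real_rooted (R : realType) (p : {poly R}) : Prop :=
  forall z : R[i], root (complexify p) z -> z \is Num.real.

(** Roots are indexed by a subset of a finite type: repeated roots stay distinct as indices, and one
    can be removed without changing the index type. *)
Definition rprod (R : realType) (I : finType) (r : I -> R) (A : {set I}) :
  {poly R} := \prod_(i in A) ('X - (r i)%:P).

(** This is [rprod r A] times the partial fraction sum of the [c i / ('X - r i)], written without
    division. *)
Definition wsum (R : realType) (I : finType) (c r : I -> R) (A : {set I}) :
  {poly R} := \sum_(i in A) c i *: rprod r (A :\ i).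

(** For a split [p] this is [p ^+ 2] times the sum of the [(x - t) ^- 2] over the roots [t], in a
    form that makes sense at a root too. *)
Definition laguerre (R : realType) (p : {poly R}) (x : R) : R :=
  p^`().[x] ^+ 2 - p.[x] * p^`()^`().[x].

(** * Split real polynomials: Laguerre-type inequalities and double roots *)

Section Split.
Variable R : realType.
Implicit Types (p q : {poly R}) (s : seq R) (x t : R).

Lemma real_rooted_split n p : p \is monic -> size p = n.+1 -> real_rooted p ->
  exists2 s : seq R, size s = n & p = \prod_(x <- s) ('X - x%:P).
Proof.
move=> mp sp rp; have [rs pE] := closed_field_poly_normal (complexify p).
have lc : lead_coef (complexify p) = 1.
  by rewrite lead_coef_map (monicP mp) rmorph1.
rewrite lc scale1r in pE.
have rsE : [seq (complex.Re z)%:C | z <- rs] = rs.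
  rewrite -[RHS]map_id; apply/eq_in_map => z zrs; apply: RRe_real; apply: rp.
  by rewrite pE root_prod_XsubC.
have pE' : p = \prod_(x <- [seq complex.Re z | z <- rs]) ('X - x%:P).
  apply: (map_poly_inj (real_complex R)); rewrite -[LHS]/(complexify p) pE.
  rewrite rmorph_prod /= big_map -[in LHS]rsE big_map.
  by apply: eq_bigr => z _; rewrite map_polyXsubC.
exists [seq complex.Re z | z <- rs] => //.
by apply/eqP; rewrite -eqSS -sp pE' size_prod_XsubC.
Qed.

Lemma laguerre_mulXsubC (x t : R) p :
  laguerre (('X - t%:P) * p) x = p.[x] ^+ 2 + (x - t) ^+ 2 * laguerre p x.
Proof. rewrite /laguerre !derivE !hornerE /=; ring. Qed.

Lemma laguerre_ge0 s x : 0 <= laguerre (\prod_(t <- s) ('X - t%:P)) x.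
Proof.
elim: s => [|t s IH].
  by rewrite big_nil /laguerre !derivE !hornerE /= expr0n /= ?oppr0 ?addr0.
by rewrite big_cons laguerre_mulXsubC addr_ge0 ?sqr_ge0 // mulr_ge0 ?sqr_ge0.
Qed.

(** One term of the sum of inverse squares is at most the whole sum; denominators are cleared. *)
Lemma laguerre_root s x (p := \prod_(t <- s) ('X - t%:P)) t : t \in s ->
  p.[x] ^+ 2 <= (x - t) ^+ 2 * laguerre p x.
Proof.
move=> ts; rewrite /p (big_rem t) //= laguerre_mulXsubC.
set h := \prod_(_ <- _) _; have := laguerre_ge0 (rem t s) x; rewrite -/h => Lh.
rewrite !hornerE exprMn mulrDr lerDl.
by rewrite mulr_ge0 ?sqr_ge0 // mulr_ge0 ?sqr_ge0.
Qed.

(** [laguerre_root] is multiplied over all roots; the factors [(x - t) ^+ 2] together give [p.[x] ^+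
    2]. *)
Lemma laguerre_expn s x (p := \prod_(t <- s) ('X - t%:P)) :
  (p.[x] ^+ 2) ^+ size s <= laguerre p x ^+ size s * p.[x] ^+ 2.
Proof.
have -> : (p.[x] ^+ 2) ^+ size s = \prod_(t <- s) p.[x] ^+ 2.
  by rewrite big_const_seq count_predT iter_mulr_1.
have -> : laguerre p x ^+ size s * p.[x] ^+ 2 =
    \prod_(t <- s) ((x - t) ^+ 2 * laguerre p x).
  rewrite big_split /= big_const_seq count_predT iter_mulr_1 mulrC.
  rewrite prodrXl; congr (_ ^+ 2 * _).
  by rewrite /p horner_prod; apply: eq_bigr => t _; rewrite !hornerE.
rewrite big_seq [leRHS]big_seq; apply: ler_prod => t ts.
by rewrite sqr_ge0 laguerre_root.
Qed.

Lemma exists_small (a b : R) : 0 < a -> 0 <= b ->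
  exists t, [/\ 0 < t, t <= 1 & t * b < a].
Proof.
move=> a0 b0; have ab : 0 < a + b + 1 by lra.
exists (a / (a + b + 1)); split; first by rewrite divr_gt0.
  by rewrite ler_pdivrMr //; lra.
by rewrite mulrAC ltr_pdivrMr // ltr_pM2l //; lra.
Qed.

(* For l of a suitable sign, laguerre (f + l *: q) x is O(l^2), whereas
   (f + l *: q).[x] = l q(x); laguerre_expn then gives q(x)^(2n) = O(l^2). *)
Lemma double_root_unperturbed (f q : {poly R}) (n : nat) x :
  (forall l, f + l *: q \is monic) -> (forall l, size (f + l *: q)%R = n.+1) ->
  (forall l, real_rooted (f + l *: q)) ->
  f.[x] = 0 -> f^`().[x] = 0 -> q.[x] = 0.
Proof.
move=> mon siz rr f0 f1; apply/eqP/negPn/negP => q0.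
set q1 := q^`().[x]; set q2 := q^`()^`().[x]; set f2 := f^`()^`().[x].
have Lag l : laguerre (f + l *: q) x =
    l ^+ 2 * (q1 ^+ 2 - q.[x] * q2) - l * q.[x] * f2.
  by rewrite /laguerre !derivE !hornerE f0 f1 -/q1 -/q2 -/f2; ring.
pose sg : R := if 0 <= q.[x] * f2 then 1 else -1.
have sg2 : sg ^+ 2 = 1 by rewrite /sg; case: ifP => _; ring.
have sgq : 0 <= sg * (q.[x] * f2).
  by rewrite /sg; case: (lerP 0 (q.[x] * f2)) => h; lra.
pose C := q1 ^+ 2 + `|q.[x] * q2|.
have C0 : 0 <= C by rewrite addr_ge0 ?sqr_ge0.
(* Both sides of [laguerre_expn] carry [(t ^+ 2) ^+ n]; cancelling it leaves a spare [t ^+ 2] on the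
   right, which is absurd for small [t]. *)
have key t : 0 < t -> (q.[x] ^+ 2) ^+ n <= C ^+ n * q.[x] ^+ 2 * t ^+ 2.
  move=> t0; pose l := sg * t.
  have [s ss fE] := real_rooted_split (mon l) (siz l) (rr l).
  have /= := laguerre_expn s x; rewrite -fE ss.
  have := laguerre_ge0 s x; rewrite -fE => L0.
  have -> : (f + l *: q).[x] = l * q.[x] by rewrite !hornerE f0 add0r.
  have LC : laguerre (f + l *: q) x <= t ^+ 2 * C.
    rewrite Lag /l exprMn sg2 mul1r.
    have h1 : q1 ^+ 2 - q.[x] * q2 <= C.
      by rewrite /C lerD2l -normrN ler_norm.
    have := ler_wpM2l (sqr_ge0 t) h1; have := mulr_ge0 (ltW t0) sgq; lra.
  have LCn : laguerre (f + l *: q) x ^+ n <= (t ^+ 2 * C) ^+ n.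
    by rewrite lerXn2r // nnegrE mulr_ge0 ?sqr_ge0.
  have -> : (l * q.[x]) ^+ 2 = t ^+ 2 * q.[x] ^+ 2.
    by rewrite /l !exprMn sg2 mul1r.
  have tq : 0 <= t ^+ 2 * q.[x] ^+ 2 by rewrite -exprMn sqr_ge0.
  move=> H; have := le_trans H (ler_wpM2r tq LCn).
  rewrite exprMn [(t ^+ 2 * C) ^+ n]exprMn -[leRHS]mulrA ler_pM2l; last first.
    by rewrite exprn_gt0 // exprn_gt0.
  by rewrite [t ^+ 2 * _]mulrC mulrA.
have A0 : 0 < (q.[x] ^+ 2) ^+ n by rewrite exprn_gt0 // exprn_even_gt0.
have B0 : 0 <= C ^+ n * q.[x] ^+ 2 by rewrite mulr_ge0 ?sqr_ge0 ?exprn_ge0.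
have [t [t0 t1 tB]] := exists_small A0 B0.
have := key t t0; rewrite leNgt => /negP; apply; apply: le_lt_trans tB.
rewrite mulrC ler_wpM2r // expr2; nra.
Qed.

End Split.

(** * Partial fraction weights along a real-rooted pencil have one sign *)

Section Interlace.
Variables (R : realType) (I : finType).
Implicit Types (p q : {poly R}) (r c : I -> R) (A : {set I}).

Lemma rprodD1 r A i : i \in A -> rprod r A = ('X - (r i)%:P) * rprod r (A :\ i).
Proof. by move=> iA; rewrite /rprod (big_setD1 i). Qed.

Lemma wsumD1 c r A i : i \in A ->
  wsum c r A = c i *: rprod r (A :\ i) + ('X - (r i)%:P) * wsum c r (A :\ i).
Proof.
move=> iA; rewrite {1}/wsum (big_setD1 i iA) /= mulr_sumr; congr (_ + _).
apply: eq_bigr => k /setD1P[ki kA]; rewrite -scalerAr; congr (_ *: _).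
rewrite (@rprodD1 r (A :\ k) i) ?inE ?(eq_sym i) ?ki //.
by rewrite !finset.setDDl finset.setUC.
Qed.

Lemma rprod_monic r A : rprod r A \is monic.
Proof. exact: monic_prod_XsubC. Qed.

Lemma size_rprod r A : size (rprod r A) = #|A|.+1.
Proof. by rewrite /rprod -big_enum size_prod_XsubC cardE. Qed.

Lemma horner_rprod r A x : (rprod r A).[x] = \prod_(i in A) (x - r i).
Proof.
by rewrite /rprod horner_prod; apply: eq_bigr => i _; rewrite !hornerE.
Qed.

Lemma size_wsum c r A : (size (wsum c r A) <= #|A|)%N.
Proof.
apply: (leq_trans (size_sum _ _ _)); apply/bigmax_leqP => i iA.
by rewrite (leq_trans (size_scale_leq _ _)) // size_rprod (cardsD1 i A) iA.
Qed.

Lemma size_pencil_member r A q l : (size q <= #|A|)%N ->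
  size (rprod r A + l *: q) = #|A|.+1.
Proof.
move=> sq; rewrite size_polyDl size_rprod // ltnS.
exact: leq_trans (size_scale_leq _ _) sq.
Qed.

Lemma monic_pencil_member r A q l : (size q <= #|A|)%N ->
  rprod r A + l *: q \is monic.
Proof.
move=> sq; rewrite monicE lead_coefDl; first exact: rprod_monic.
by rewrite size_rprod ltnS (leq_trans (size_scale_leq _ _) sq).
Qed.

Lemma horner_wsum_node c r A i : i \in A ->
  (wsum c r A).[r i] = c i * \prod_(l in A :\ i) (r i - r l).
Proof.
move=> iA; rewrite /wsum (big_setD1 i) //= hornerD hornerZ horner_rprod.
rewrite horner_sum [X in _ + X]big1 ?addr0 // => k /setD1P[ki kA].
rewrite hornerZ horner_rprod (big_setD1 i) /= ?subrr ?mul0r ?mulr0 //.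
by rewrite !inE eq_sym ki.
Qed.

(** There are finitely many roots. Below height [d] in the upper half plane [q] has no zero, which
    keeps [q / f] nonzero on the chosen horizontal line. *)
Lemma exists_Im_gap q : q != 0 -> exists2 d : R, 0 < d &
  forall z : R[i], root (complexify q) z -> 0 < complex.Im z ->
    d <= complex.Im z.
Proof.
move=> q0; have [rs qE] := closed_field_poly_normal (complexify q).
have q0' : lead_coef (complexify q) != 0 by rewrite lead_coef_eq0 map_poly_eq0.
suff [d d0 H] : exists2 d : R, 0 < d &
    forall z, z \in rs -> 0 < complex.Im z -> d <= complex.Im z.
  by exists d => // z; rewrite qE rootZ // root_prod_XsubC; apply: H.
elim: rs {qE} => [|w rs [d d0 IH]]; first by exists 1 => //; rewrite ltr01.
have [w0|w0] := lerP (complex.Im w) 0.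
  exists d => // z /[!inE] /orP[/eqP->|/IH//]; lra.
exists (Num.min d (complex.Im w)); first by rewrite lt_min d0.
move=> z /[!inE] /orP[/eqP->|/IH H /H le_dz].
  by rewrite ge_min lexx orbT.
by rewrite ge_min le_dz.
Qed.

Lemma poly_pos_near0 p : 0 < p.[0] ->
  exists2 d : R, 0 < d & forall t, 0 < t -> t < d -> 0 < p.[t].
Proof.
move=> p0; have [d d0 H] := poly_cont 0 p p0; exists d => // t t0 td.
have := H t; rewrite subr0 gtr0_norm // => /(_ td); rewrite ltr_norml; lra.
Qed.

(* At z = x + di this sum is, up to the positive factor |f(z)|^2 / d, minus the
   imaginary part of (q / f)(z), where f = rprod r A and q = wsum c r A. *)
Definition imsum c r A (x d : R) : R :=
  \sum_(k in A) c k * \prod_(l in A :\ k) ((x - r l) ^+ 2 + d ^+ 2).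

(** At [d = 0] only the term of [i] survives at [r i], and it is positive because the nodes are
    distinct; continuity in [d] does the rest. *)
Lemma imsum_pos c r A i : {in A &, injective r} -> i \in A -> 0 < c i ->
  exists2 d0 : R, 0 < d0 & forall d, 0 < d -> d < d0 -> 0 < imsum c r A (r i) d.
Proof.
move=> rI iA ci.
pose p := \sum_(k in A) c k *:
  \prod_(l in A :\ k) (((r i - r l) ^+ 2)%:P + 'X^2).
have pE d : p.[d] = imsum c r A (r i) d.
  rewrite /p horner_sum; apply: eq_bigr => k _; rewrite hornerZ horner_prod.
  by congr (_ * _); apply: eq_bigr => l _; rewrite !hornerE.
have p0 : 0 < p.[0].
  rewrite pE /imsum (big_setD1 i) //= [X in _ + X]big1 => [|k /setD1P[ki kA]].
    rewrite addr0 mulr_gt0 // prodr_gt0 // => l /setD1P[li lA].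
    rewrite expr0n addr0 exprn_even_gt0 //= subr_eq0.
    by apply: contra li => /eqP /rI ->.
  rewrite (big_setD1 i) /= ?subrr ?expr0n ?addr0 ?mul0r ?mulr0 //.
  by rewrite !inE eq_sym ki.
have [d d0 H] := poly_pos_near0 p0; exists d => // t t0 td.
by rewrite -pE H.
Qed.

Lemma imsumN c r A x d : imsum (fun i => - c i) r A x d = - imsum c r A x d.
Proof. by rewrite /imsum -sumrN; apply: eq_bigr => k _; rewrite mulNr. Qed.

Lemma imsum_zero c r A i j (d : R) : 0 < imsum c r A (r i) d ->
  imsum c r A (r j) d < 0 -> exists x, imsum c r A x d = 0.
Proof.
pose p := \sum_(k in A) c k *:
  \prod_(l in A :\ k) (('X - (r l)%:P) ^+ 2 + (d ^+ 2)%:P).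
have pE x : p.[x] = imsum c r A x d.
  rewrite /p horner_sum; apply: eq_bigr => k _; rewrite hornerZ horner_prod.
  by congr (_ * _); apply: eq_bigr => l _; rewrite !hornerE.
rewrite -!pE => pi pj; have pij : p.[r i] * p.[r j] <= 0 by nra.
have [le_ij|/ltW le_ji] := lerP (r i) (r j).
  by have [x _ /rootP xr] := polyrcf.poly_ivt le_ij pij; exists x; rewrite -pE.
rewrite mulrC in pij.
by have [x _ /rootP xr] := polyrcf.poly_ivt le_ji pij; exists x; rewrite -pE.
Qed.

Lemma complexify_rprod r A z :
  (complexify (rprod r A)).[z] = \prod_(i in A) (z - (r i)%:C).
Proof.
rewrite /complexify /rprod rmorph_prod horner_prod.
by apply: eq_bigr => i _; rewrite /= map_polyXsubC !hornerE.
Qed.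

Lemma complexify_wsum c r A z : (complexify (wsum c r A)).[z] =
  \sum_(i in A) (c i)%:C * \prod_(l in A :\ i) (z - (r l)%:C).
Proof.
rewrite /complexify /wsum rmorph_sum horner_sum; apply: eq_bigr => i _.
by rewrite /= map_polyZ hornerZ -/(complexify _) complexify_rprod.
Qed.

(** In the term of [k], the factors at [l != k] pair with their conjugates into squared moduli, and
    one conjugate factor is left over. The imaginary part is therefore [- d * imsum c r A x d]. *)
Lemma wsum_mul_conj c r A (x d : R) (z := x +i* d) :
  (complexify (wsum c r A)).[z] * ((complexify (rprod r A)).[z])^*%C =
  \sum_(k in A)
    (c k * \prod_(l in A :\ k) ((x - r l) ^+ 2 + d ^+ 2))%:C
    * (z^*%C - (r k)%:C).
Proof.
rewrite complexify_wsum complexify_rprod big_distrl; apply: eq_bigr => k kA /=.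
rewrite (big_setD1 k kA) 2!rmorphM 2!rmorph_prod -!mulrA.
congr (_ * _); rewrite mulrCA mulrC; congr (_ * _); last first.
  by apply/eqP; rewrite eq_complex /=; apply/andP; split; apply/eqP; ring.
rewrite -big_split /=; apply: eq_bigr => l _.
by apply/eqP; rewrite eq_complex /=; apply/andP; split; apply/eqP; ring.
Qed.

Lemma wsum_same_sign c r A i j : {in A &, injective r} ->
  (forall l, real_rooted (rprod r A + l *: wsum c r A)) ->
  i \in A -> j \in A -> 0 < c i -> c j < 0 -> False.
Proof.
move=> rI rr iA jA ci cj.
have q0 : wsum c r A != 0.
  apply/eqP => q0; have := horner_wsum_node c r iA; rewrite q0 horner0.
  move/esym/eqP; rewrite mulf_eq0 gt_eqF //=; apply/negP/prodf_neq0 => l.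
  by move=> /setD1P[li lA]; rewrite subr_eq0; apply: contra li => /eqP/rI->.
have [d1 d10 H1] := imsum_pos rI iA ci.
have [|d2 d20 H2] := @imsum_pos (fun k => - c k) r A j rI jA; first lra.
have [d3 d30 H3] := exists_Im_gap q0.
(* Below [d1] and [d2] the sums at [r i] and [r j] have opposite signs; below [d3] the polynomial
   [wsum c r A] has no zero at height [d]. *)
pose d := Num.min d1 (Num.min d2 d3) / 2.
have m0 : 0 < Num.min d1 (Num.min d2 d3) by rewrite !lt_min d10 d20.
have [d0 d1d d2d d3d] : [/\ 0 < d, d < d1, d < d2 & d < d3].
  have : Num.min d1 (Num.min d2 d3) <= d1 by rewrite ge_min lexx.
  have : Num.min d1 (Num.min d2 d3) <= d2 by rewrite !ge_min lexx orbT.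
  have : Num.min d1 (Num.min d2 d3) <= d3 by rewrite !ge_min lexx !orbT.
  by rewrite /d; split; lra.
have Si := H1 d d0 d1d; have Sj := H2 d d0 d2d.
rewrite imsumN oppr_gt0 in Sj.
have [x Sx] := imsum_zero Si Sj.
pose z := x +i* d.
have zN : z \isn't Num.real by rewrite complex_real gt_eqF.
pose F := (complexify (rprod r A)).[z]; pose Q := (complexify (wsum c r A)).[z].
have F0 : F != 0.
  rewrite /F complexify_rprod; apply/prodf_neq0 => k kA; rewrite subr_eq0.
  by apply/eqP => /(congr1 (@complex.Im R)) /= dd; rewrite dd ltxx in d0.
have Q0 : Q != 0.
  apply/negP => qz; have := H3 z; rewrite /root => /(_ qz) /=.
  by move=> /(_ d0); lra.
(* The coefficient of the conjugate of [z] in [wsum_mul_conj] is [imsum], zero at [x]; only this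
   real number remains. *)
pose rho : R := - \sum_(k in A)
  (c k * \prod_(l in A :\ k) ((x - r l) ^+ 2 + d ^+ 2)) * r k.
have QF : Q * F^*%C = rho%:C.
  rewrite /Q /F wsum_mul_conj.
  under eq_bigr do rewrite mulrBr.
  rewrite sumrB -mulr_suml -rmorph_sum /= -[X in X%:C]/(imsum c r A x d) Sx.
  rewrite rmorph0 mul0r sub0r /rho rmorphN rmorph_sum /=.
  by congr GRing.opp; apply: eq_bigr => k _; rewrite -rmorphM.
have F0' : F^*%C != 0 by rewrite conjc_eq0.
have rho0 : rho != 0.
  apply/eqP => r0; move: QF; rewrite r0 => /eqP.
  by rewrite mulf_eq0 (negbTE Q0) (negbTE F0').
have [N NE] : exists N : R, F * F^*%C = N%:C.
  exists (complex.Re F ^+ 2 + complex.Im F ^+ 2).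
  by rewrite -sqr_normc add_Re2_Im2.
have : z \is Num.real.
  (* Multiplied by the conjugate of [F], the equation [F + l Q = 0] reads [N + l rho = 0]. *)
  apply: (rr (- (N / rho))); apply/rootP.
  rewrite /complexify rmorphD /= map_polyZ hornerD hornerZ.
  rewrite -/(complexify _) -/F -/(complexify _) -/Q.
  apply/eqP; rewrite -(mulIr_eq0 _ (mulIf F0')) mulrDl -mulrA QF NE.
  by rewrite -rmorphM -rmorphD /= mulNr divfK ?subrr.
by rewrite (negbTE zN).
Qed.

End Interlace.

(** * Existence of the one-signed decomposition *)

Section Decomposition.
Variables (R : realType) (I : finType).
Implicit Types (p q : {poly R}) (r c : I -> R) (A : {set I}).

Lemma real_rooted_mulXsubC a p : real_rooted (('X - a%:P) * p) -> real_rooted p.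
Proof.
move=> H z pz; apply: H; rewrite /complexify rmorphM /= rootM -/(complexify p).
by rewrite pz orbT.
Qed.

(** A repeated node is a double root of [rprod r A], hence a root of [q] by
    [double_root_unperturbed]. *)
Lemma rprod_injective r A q : (size q <= #|A|)%N ->
  (forall l, real_rooted (rprod r A + l *: q)) ->
  {in A, forall i, ~~ root q (r i)} -> {in A &, injective r}.
Proof.
move=> sq rr nq i j iA jA rij; apply/eqP/negPn/negP => nij.
have jA' : j \in A :\ i by rewrite !inE eq_sym nij.
have fE : rprod r A = ('X - (r i)%:P) ^+ 2 * rprod r (A :\ i :\ j).
  by rewrite (rprodD1 r iA) (rprodD1 r jA') -rij mulrA -expr2.
have /negP := nq i iA; apply.
apply/eqP; apply: (@double_root_unperturbed _ (rprod r A) q #|A|) => //.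
- by move=> l; apply: monic_pencil_member.
- by move=> l; apply: size_pencil_member.
- by rewrite fE !hornerE subrr expr0n /= mul0r.
- by rewrite fE expr2 !derivE !hornerE /=; ring.
Qed.

(** Lagrange interpolation: both sides have size at most [#|A|] and agree at [#|A|] distinct
    nodes. *)
Lemma lagrange_wsum r A q : {in A &, injective r} -> (size q <= #|A|)%N ->
  q = wsum (fun k => q.[r k] / \prod_(l in A :\ k) (r k - r l)) r A.
Proof.
move=> rI sq; apply/eqP; rewrite -subr_eq0; apply/eqP.
set w := wsum _ r A.
apply: (@roots_geq_poly_eq0 _ _ [seq r k | k <- enum A]).
- apply/allP => x /mapP[k]; rewrite mem_enum => kA ->.
  rewrite /root hornerD hornerN /w horner_wsum_node // divfK ?subrr //.
  apply/prodf_neq0 => l /setD1P[lk lA]; rewrite subr_eq0.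
  by apply: contra lk => /eqP/rI->.
- rewrite map_inj_in_uniq ?enum_uniq // => k l; rewrite !mem_enum.
  exact: rI.
- rewrite size_map -cardE (leq_trans (size_polyD _ _)) // size_polyN.
  by rewrite geq_max sq size_wsum.
Qed.

Lemma interlacing_decomposition r A q : (size q <= #|A|)%N ->
    (forall l, real_rooted (rprod r A + l *: q)) ->
  exists2 c : I -> R, q = wsum c r A &
    (forall i, 0 <= c i) \/ (forall i, c i <= 0).
Proof.
have [n] := ubnP #|A|; elim: n => // n IH in A q * => An sq rr.
have [/existsP[i /andP[iA /factor_theorem[q' qE]]]|] :=
  boolP [exists i, (i \in A) && root q (r i)].
  rewrite mulrC in qE.
  have cA : #|A| = #|A :\ i|.+1 by rewrite (cardsD1 i A) iA.
  have [||l|c cE cs] := IH (A :\ i) q'.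
  - by rewrite cA in An.
  - have [->|q'0] := eqVneq q' 0; first by rewrite size_poly0.
    move: sq; rewrite qE mulrC size_Mmonic ?monicXsubC //.
    by rewrite size_XsubC cA addn2.
  - apply: (@real_rooted_mulXsubC (r i)); rewrite mulrDr -rprodD1 //.
    by rewrite -scalerAr -qE; apply: rr.
  (* A common root gets weight 0, so that every remaining term regains the factor ['X - r i]. *)
  exists (fun k => if k == i then 0 else c k); last first.
    by case: cs => cs; [left|right] => k; case: ifP.
  rewrite qE cE (wsumD1 _ _ iA) eqxx scale0r add0r; congr (_ * _).
  by apply: eq_bigr => k /setD1P[ki _]; rewrite (negbTE ki).
rewrite negb_exists => /forallP nq.
have nr : {in A, forall i, ~~ root q (r i)}.
  by move=> i iA; have := nq i; rewrite iA.
have rI := rprod_injective sq rr nr.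
have qE := lagrange_wsum rI sq; set c := (X in wsum X) in qE.
(* The sign condition ranges over all of [I], so the weights are set to 0 outside [A]. *)
pose c' k := if k \in A then c k else 0.
have qE' : q = wsum c' r A.
  by rewrite {1}qE; apply: eq_bigr => k kA; rewrite /c' kA.
exists c' => //.
have [/existsP[i ci]|] := boolP [exists i, 0 < c' i]; last first.
  by rewrite negb_exists => /forallP ci; right=> i; rewrite leNgt ci.
left=> j; rewrite leNgt; apply/negP => cj; rewrite qE' in rr.
apply: (wsum_same_sign rI rr _ _ ci cj).
  by move: ci; rewrite /c'; case: ifP; rewrite ?ltxx.
by move: cj; rewrite /c'; case: ifP; rewrite ?ltxx.
Qed.

End Decomposition.

(** * Extremal roots and one-sided bounds for them *)

Section Extremal.
Variables (R : realType).
Implicit Types (p q f : {poly R}).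

(** The sign conditions allow a root to be bounded by exhibiting one point of the wrong sign. The
    coefficient bounds compare the sum of the roots, by Vieta, with [n] times each extreme. *)
Lemma extremal_roots n p : (0 < n)%N -> hyperbolic n p ->
  exists lo hi : R,
    [/\ root p lo, root p hi & Defs.span (complexify p) = hi - lo] /\
    [/\ forall x, hi < x -> 0 < p.[x],
        forall x, x < lo -> 0 < (-1) ^+ n * p.[x] &
        lo *+ n <= - p`_n.-1 <= hi *+ n].
Proof.
move=> n0 hp; have [lo [hi [rlo rhi bnd spE]]] := span_max_min n0 hp.
have rC x : zeros (complexify p) x%:C = root p x.
  by rewrite /zeros /= fmorph_root.
rewrite !rC in rlo rhi; exists lo, hi; split=> //.
have [[mp sp] rp] := hp; have [s ss pE] := real_rooted_split mp sp rp.
have sb t : t \in s -> lo <= t <= hi.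
  by move=> ts; apply: bnd; rewrite rC pE root_prod_XsubC.
have px x : p.[x] = \prod_(t <- s) (x - t).
  by rewrite pE horner_prod; apply: eq_bigr => t _; rewrite !hornerE.
split.
- move=> x hx; rewrite px big_seq prodr_gt0 // => t /sb; lra.
- move=> x hx; rewrite px -ss.
  have -> : (-1) ^+ size s = \prod_(t <- s) -1 :> R.
    by rewrite big_const_seq count_predT iter_mulr_1.
  by rewrite -big_split big_seq prodr_gt0 // => t /sb /=; lra.
- rewrite {1 2}pE -ss coefPn_prod_XsubC ?ss -?lt0n // opprK.
  have cst (u : R) : u *+ size s = \sum_(t <- s) u.
    by rewrite big_const_seq count_predT iter_addr_0.
  by rewrite -ss !cst; apply/andP; split; rewrite big_seq [leRHS]big_seq;
    apply: ler_sum => t /sb /andP[].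
Qed.

Variable I : finType.
Implicit Types (r c : I -> R) (A : {set I}).

Lemma rprod_ge0 r A x : {in A, forall j, r j <= x} -> 0 <= (rprod r A).[x].
Proof.
by move=> rx; rewrite horner_rprod prodr_ge0 // => j jA; rewrite subr_ge0 rx.
Qed.

Lemma wsum_ge0 c r A x : (forall j, 0 <= c j) ->
  {in A, forall j, r j <= x} -> 0 <= (wsum c r A).[x].
Proof.
move=> c0 rx; rewrite /wsum horner_sum sumr_ge0 // => j jA.
rewrite hornerZ mulr_ge0 // rprod_ge0 // => k /setD1P[_ kA]; exact: rx.
Qed.

Lemma exists_argmax r A : (0 < #|A|)%N ->
  exists2 i, i \in A & {in A, forall j, r j <= r i}.
Proof.
move=> /card_gt0P[i0 i0A]; case: (arg_maxP r i0A) => i iA H.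
by exists i.
Qed.

(** A point where the polynomial is nonpositive lies at or below [y]. The point [r i - t * c i]
    cancels the first term of [val]; for [t >= 0] the second largest node [r k] always works and
    serves as [b]. *)
Lemma top_root_bounds r c A : (2 <= #|A|)%N -> (forall i, 0 <= c i) ->
  exists2 i, i \in A /\ {in A, forall j, r j <= r i} &
  exists b, forall t y,
    (forall x, y < x -> 0 < (rprod r A + t *: wsum c r A).[x]) ->
    r i - t * c i <= y /\ (0 <= t -> b <= y).
Proof.
move=> A2 c0; have [|i iA imax] := @exists_argmax r A; first exact: ltnW.
have [|k kA kmax] := @exists_argmax r (A :\ i).
  by move: A2; rewrite (cardsD1 i A) iA ltnS.
exists i => //; exists (r k) => t y pos.
have ki : r k <= r i by apply: imax; case/setD1P: kA.
have val x : (rprod r A + t *: wsum c r A).[x] =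
    (x - r i + t * c i) * (rprod r (A :\ i)).[x]
    + t * (x - r i) * (wsum c r (A :\ i)).[x].
  by rewrite (rprodD1 r iA) (wsumD1 c r iA) !hornerE /=; ring.
have gk : (rprod r (A :\ i)).[r k] = 0.
  by rewrite horner_rprod (big_setD1 k kA) /= subrr mul0r.
have le_y x : (rprod r A + t *: wsum c r A).[x] <= 0 -> x <= y.
  by move=> px; rewrite leNgt; apply/negP => /pos; rewrite ltNge px.
have h0 := wsum_ge0 c0 kmax.
have ky : t * (r k - r i) <= 0 -> r k <= y.
  by move=> tk; apply: le_y; rewrite val gk mulr0 add0r mulr_le0_ge0.
split=> [|t0]; last by apply: ky; rewrite mulr_ge0_le0 // subr_le0.
have [xk|kx] := lerP (r i - t * c i) (r k).
  apply: (le_trans xk); apply: ky; have [t0|t0] := lerP 0 t.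
    by rewrite mulr_ge0_le0 // subr_le0.
  (* For [t < 0] the point [r i - t * c i] is at least [r i], so lying below [r k] forces
     [r k = r i]. *)
  have tc : t * c i <= 0 by rewrite mulr_le0_ge0 // ltW.
  by rewrite (_ : r k - r i = 0) ?mulr0 //; lra.
apply: le_y; rewrite val.
have h1 : 0 <= (wsum c r (A :\ i)).[r i - t * c i].
  by apply: wsum_ge0 => // j /kmax /le_trans; apply; apply: ltW.
have -> : r i - t * c i - r i + t * c i = 0 by ring.
rewrite mul0r add0r mulr_le0_ge0 //.
have -> : t * (r i - t * c i - r i) = - (t ^+ 2 * c i) by ring.
by rewrite oppr_le0 mulr_ge0 ?sqr_ge0.
Qed.

End Extremal.

(** * Subgradients, coercivity and minimum of the span *)

Section Pencil.
Variables (R : realType).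
Implicit Types (p q f : {poly R}).

Section Bounds.
Variable I : finType.
Implicit Types (r c : I -> R) (A : {set I}).

Lemma rprod_opp r A x :
  (rprod (fun i => - r i) A).[- x] = (-1) ^+ #|A| * (rprod r A).[x].
Proof.
rewrite !horner_rprod -prodrN; apply: eq_bigr => i _; ring.
Qed.

Lemma wsum_opp c r A x :
  (wsum c (fun i => - r i) A).[- x] = - ((-1) ^+ #|A| * (wsum c r A).[x]).
Proof.
rewrite /wsum !horner_sum mulr_sumr -sumrN; apply: eq_bigr => i iA.
by rewrite !hornerZ rprod_opp (cardsD1 i A) iA exprS; ring.
Qed.

(** Reflection [x -> - x] applied to [top_root_bounds]. The parameter changes sign as well, because
    the terms of [wsum] have one factor fewer than [rprod]. *)
Lemma bottom_root_bounds r c A : (2 <= #|A|)%N -> (forall i, 0 <= c i) ->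
  exists2 i, i \in A /\ {in A, forall j, r i <= r j} &
  exists b, forall t y,
    (forall x, x < y -> 0 < (-1) ^+ #|A| * (rprod r A + t *: wsum c r A).[x]) ->
    y <= r i - t * c i /\ (t <= 0 -> y <= b).
Proof.
move=> A2 c0.
have [i [iA imax] [b H]] := @top_root_bounds R I (fun i => - r i) c A A2 c0.
exists i; first by split=> // j /imax; rewrite lerN2.
exists (- b) => t y pos; have [|H1 H2] := H (- t) (- y).
  move=> x; rewrite ltrNl => /pos.
  have := rprod_opp r A (- x); have := wsum_opp c r A (- x).
  by rewrite !opprK !hornerE => -> ->; rewrite mulrDr; lra.
split; first lra.
by move=> t0; have := H2; rewrite oppr_ge0 => /(_ t0); lra.
Qed.

Lemma coef_wsum c r A : (0 < #|A|)%N ->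
  (wsum c r A)`_#|A|.-1 = \sum_(i in A) c i.
Proof.
move=> A0; rewrite /wsum coef_sum; apply: eq_bigr => i iA.
have -> : #|A|.-1 = (size (rprod r (A :\ i))).-1.
  by rewrite size_rprod (cardsD1 i A) iA.
by rewrite coefZ -lead_coefE (monicP (rprod_monic _ _)) mulr1.
Qed.

Lemma pencil_span_bounds_nonneg r c A (f := rprod r A) (q := wsum c r A)
    (phi := fun t => Defs.span (complexify (f + t *: q))) :
  (2 <= #|A|)%N -> (forall i, 0 <= c i) -> q != 0 ->
  (forall t, hyperbolic #|A| (f + t *: q)) ->
  exists s a K, 0 < a /\ forall t,
    phi 0 + t * s <= phi t /\ a * `|t| - K <= phi t.
Proof.
move=> A2 c0 q0 hyp; have A0 : (0 < #|A|)%N by apply: ltnW.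
have [i [iA imax] [b top]] := top_root_bounds r A2 c0.
have [j [jA jmin] [b' bot]] := bottom_root_bounds r A2 c0.
set n := #|A| in hyp A2 A0 bot *.
have n0 : 0 < n%:R :> R by rewrite ltr0n.
have qn : 0 < q`_n.-1.
  rewrite coef_wsum // lt_neqAle sumr_ge0 // andbT eq_sym.
  apply: contra q0 => /eqP /psumr_eq0P cz; rewrite /q /wsum big1 // => k kA.
  by rewrite cz // scale0r.
have phi0 : phi 0 <= r i - r j.
  have [lo [hi [[rlo rhi spE] _]]] := extremal_roots A0 (hyp 0).
  rewrite /phi spE; rewrite scale0r addr0 in rlo rhi.
  have node x : root f x -> r j <= x <= r i.
    rewrite /root horner_rprod => /prodf_eq0[k kA]; rewrite subr_eq0 => /eqP->.
    by rewrite jmin // imax.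
  by have /andP[_ ?] := node _ rhi; have /andP[? _] := node _ rlo; lra.
(* The slope is the difference of those of the two supporting lines. The mean of the roots moves at
   speed [q_(n-1) / n]; the last constant absorbs [b], [b'] and the mean at [t = 0]. *)
exists (c j - c i), (q`_n.-1 / n%:R), (`|b| + `|b'| + `|f`_n.-1 / n%:R|).
split=> [|t]; first by rewrite divr_gt0.
have [lo [hi [[_ _ spE] [hpos lpos /andP[mlo mhi]]]]] :=
  extremal_roots A0 (hyp t).
have [top1 top2] := top t hi hpos; have [bot1 bot2] := bot t lo lpos.
have -> : phi t = hi - lo by [].
split; first lra.
set a := q`_n.-1 / _; set u := f`_n.-1 / _.
have mE : - (f + t *: q)`_n.-1 = (- u - t * a) * n%:R.
  by rewrite coefD coefZ /u /a; field; rewrite gt_eqF.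
have lo_le : lo <= - u - t * a by rewrite -(ler_pM2r n0) -mE mulr_natr.
have hi_ge : - u - t * a <= hi by rewrite -(ler_pM2r n0) -mE mulr_natr.
have := ler_norm (- b); have := ler_norm b'; have := ler_norm (- u).
have := ler_norm u; have := normr_ge0 b'; have := normr_ge0 b; rewrite !normrN.
(* For [t >= 0], [hi] stays above [b] while [lo] is below the decreasing mean; for [t <= 0] the
   roles are exchanged. *)
have [t0|/ltW t0] := lerP 0 t.
  by rewrite (ger0_norm t0); have := top2 t0; lra.
by rewrite (ler0_norm t0); have := bot2 t0; lra.
Qed.

End Bounds.

(** Nonpositive weights reduce to nonnegative ones by replacing [q] and [t] with their opposites,
    which negates the slope [s]. *)
Lemma pencil_span_bounds n f q
    (phi := fun t => Defs.span (complexify (f + t *: q))) :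
  (2 <= n)%N -> q != 0 -> (forall t, hyperbolic n (f + t *: q)) ->
  exists s a K, 0 < a /\ forall t,
    phi 0 + t * s <= phi t /\ a * `|t| - K <= phi t.
Proof.
move=> n2 q0 hyp.
have [[mf sf] rf] := hyp 0; rewrite scale0r addr0 in mf sf rf.
have [s ss fE] := real_rooted_split mf sf rf.
pose r (i : 'I_n) := nth 0 s i; pose A := finset.setTfor 'I_n.
have cA : #|A| = n by rewrite cardsT card_ord.
have frE : f = rprod r A.
  rewrite fE (big_nth 0) ss big_mkord; apply: eq_bigl => i.
  by rewrite finset.in_setT.
have sq : (size q <= #|A|)%N.
  have [[m1 s1] _] := hyp 1; rewrite scale1r in m1 s1.
  have -> : q = f + q - f by rewrite addrC addKr.
  rewrite cA; apply/leq_sizeP => k nk; rewrite coefB.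
  have [->|kn] := eqVneq k n; last first.
    have nk' : (n.+1 <= k)%N by rewrite ltn_neqAle eq_sym kn.
    by rewrite !nth_default ?subrr ?sf ?s1.
  have /monicP := m1; have /monicP := mf; rewrite !lead_coefE sf s1 /= => -> ->.
  by rewrite subrr.
have [|c qE cs] := @interlacing_decomposition R _ r A q sq.
  by move=> t; rewrite -frE; case: (hyp t).
case: cs => cs.
  rewrite /phi frE qE; apply: pencil_span_bounds_nonneg; rewrite ?cA -?qE //.
  by move=> t; rewrite -frE.
have qE' : - q = wsum (fun i => - c i) r A.
  by rewrite qE /wsum -sumrN; apply: eq_bigr => i _; rewrite scaleNr.
have [||||d [a [K [a0 H]]]] :=
  @pencil_span_bounds_nonneg _ r (fun i => - c i) A.
- by rewrite cA.
- by move=> i; rewrite oppr_ge0.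
- by rewrite -qE' oppr_eq0.
- by move=> t; rewrite -frE -qE' scalerN -scaleNr cA.
have flip u : f + (- u) *: - q = f + u *: q by rewrite scalerN scaleNr opprK.
exists (- d), a, K; split=> // t; have := H (- t).
by rewrite -frE -qE' flip -[X in X *: - q]oppr0 flip normrN mulNr -mulrN.
Qed.

(* The minimum is attained at the supremum of the points having a negative
   subgradient. *)
Lemma subgradient_coercive_min (phi : R -> R) (a K : R) : 0 < a ->
  (forall u, exists s, forall t, phi u + (t - u) * s <= phi t) ->
  (forall t, a * `|t| - K <= phi t) ->
  exists m, forall t, phi m <= phi t.
Proof.
move=> a0 /choice[s sP] coer.
(* Beyond [M] coercivity puts [phi] above [phi 0], so subgradients are nonnegative from [M] on and
   negative at [- M]: [S] is nonempty and bounded above. *)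
pose M := (`|phi 0| + `|K| + 1) / a.
have M0 : 0 < M by rewrite divr_gt0 // ltr_wpDl // addr_ge0.
have bigM t : M <= `|t| -> phi 0 < phi t.
  move=> Mt; apply: lt_le_trans (coer t).
  have : a * M <= a * `|t| by rewrite ler_pM2l.
  rewrite /M mulrC divfK ?gt_eqF //.
  by have := ler_norm (phi 0); have := ler_norm K; lra.
have sM t : M <= t -> 0 <= s t.
  move=> Mt; rewrite leNgt; apply/negP => st.
  have := sP t 0; have := bigM t; rewrite ger0_norm; last lra.
  move=> /(_ Mt); nra.
have sNM : s (- M) < 0.
  have h : phi 0 < phi (- M) by apply: bigM; rewrite normrN ger0_norm // ltW.
  have := sP (- M) 0; rewrite sub0r opprK -(pmulr_rlt0 (s (- M)) M0); lra.
pose S := [set u | s u < 0].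
have hS : has_sup S.
  split; first by exists (- M).
  exists M => u; rewrite /S /= => su.
  by rewrite leNgt; apply/negP => /ltW /sM; lra.
pose m := sup S; exists m => t; apply/ler_addgt0Pr => e e0.
have [d [d0 d1 de]] := exists_small e0 (normr_ge0 (s m)).
(* The subgradient at [m] itself controls [phi] from below near [m]; no continuity is invoked. *)
have near u : `|u - m| <= d -> phi m - e <= phi u.
  move=> um; apply: le_trans (sP m u).
  have : `|(u - m) * s m| <= d * `|s m| by rewrite normrM ler_wpM2r.
  have := ler_norm (- ((u - m) * s m)); rewrite normrN; lra.
have [tm|] := ltrP t m.
  (* A point [u] of [S] in []w, m]] is near [m], and its negative subgradient gives
     [phi u <= phi t]. *)
  pose w := Num.max t (m - d).
  have wm : 0 < m - w by rewrite subr_gt0 gt_max tm /=; lra.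
  have [u su] := sup_adherent wm hS; rewrite -/m opprB addrC subrK => wu.
  have um : u <= m by apply: ub_le_sup => //; case: hS.
  have [tw dw] : t <= w /\ m - d <= w by rewrite /w !le_max !lexx orbT.
  have := sP u t; have := near u; rewrite ler0_norm; last lra.
  have : 0 <= (t - u) * s u by rewrite mulr_le0 //; [lra | exact: ltW].
  by move=> h1 h2; have := h2 ltac:(lra); lra.
rewrite le_eqVlt => /predU1P[<-|mt]; first lra.
pose u := Num.min t (m + d).
have mu : m < u by rewrite lt_min mt /=; lra.
have [ut ud] : u <= t /\ u <= m + d by rewrite /u !ge_min !lexx orbT.
have su : 0 <= s u.
  rewrite leNgt; apply/negP => su.
  have : u <= m by apply: ub_le_sup => //; case: hS.
  lra.
have := sP u t; have := near u; rewrite gtr0_norm; last lra.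
have : 0 <= (t - u) * s u by rewrite mulr_ge0 //; lra.
by move=> h1 h2; have := h2 ltac:(lra); lra.
Qed.

End Pencil.

Theorem corollary1 (R : realType) (n : nat) (hn : (2 <= n)%N)
    (L : set {poly R}) (hL : is_pencil n L) (hLH : L `<=` hyperbolic n)
    (T : {linear {poly R[i]} -> {poly R[i]}}) (hT : preserves_hyperbolic n T) :
  convex_function L (twisted_span T) /\
  exists2 P0 : {poly R}, L P0 &
    forall P : {poly R}, L P -> twisted_span T P0 <= twisted_span T P.
Proof.
have [P1 [P2 [mP1 mP2 _ LE]]] := hL.
pose P (l : R) := (1 - l) *: P1 + l *: P2.
have LP l : L (P l) by rewrite LE; exists l.
have PL p : L p -> exists l, p = P l by rewrite LE => -[l _ <-]; exists l.
have imT l : exists2 t, hyperbolic n t & complexify t = T (complexify (P l)).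
  have [|t ht tE] := hT (T (complexify (P l))); last by exists t.
  exists (complexify (P l)) => //; exists (P l) => //; exact: hLH.
(* By linearity the images of two members determine the image of the whole pencil. *)
have [f _ fE] := imT 0; have [g _ gE] := imT 1.
pose q := g - f.
pose phi l := Defs.span (complexify (f + l *: q)).
have TP l : T (complexify (P l)) = complexify (f + l *: q).
  have cP u : complexify (P u) =
      complexify P1 + u%:C *: (complexify P2 - complexify P1).
    rewrite -[complexify P2 - _]rmorphB /= -map_polyZ -rmorphD /=.
    by congr complexify; rewrite /P scalerBl scale1r scalerBr addrAC -addrA.
  rewrite cP linearD linearZ /= [complexify (_ + _)]rmorphD /= map_polyZ /=.
  rewrite [map_poly _ q]rmorphB /= -!/(complexify _) fE gE !cP rmorph0 rmorph1.
  by rewrite scale0r scale1r addr0 [complexify P1 + (_ - _)]addrC subrK linearB.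
have phiE l : twisted_span T (P l) = phi l by rewrite /twisted_span TP.
have hyp l : hyperbolic n (f + l *: q).
  have [t ht] := imT l; rewrite TP.
  by move/(map_poly_inj (real_complex R)) => <-.
have sub u : exists s, forall t, phi u + (t - u) * s <= phi t.
  (* When [T] collapses the pencil to one polynomial, [phi] is constant. Otherwise the line is
     rebased at parameter [u]. *)
  have [q0|q0] := eqVneq q 0.
    by exists 0 => t; rewrite /phi q0 !scaler0 mulr0 addr0.
  have hu t : hyperbolic n ((f + u *: q) + t *: q).
    by rewrite -addrA -scalerDl; apply: hyp.
  have [s [a [K [_ H]]]] := pencil_span_bounds hn q0 hu.
  exists s => t; have [+ _] := H (t - u).
  have -> : f + u *: q + (t - u) *: q = f + t *: q.
    by rewrite -addrA -scalerDl subrKC.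
  by rewrite scale0r addr0.
split.
  move=> t x y /[!inE] /PL[lx ->] /PL[ly ->].
  pose v : R := t%:inum; have v0 : 0 <= v by rewrite /v.
  have v1 : v <= 1 by rewrite /v.
  have -> : conv t (P lx : convex_lmodType _) (P ly) =
      P (v * lx + (1 - v) * ly).
    rewrite -[LHS]/(v *: P lx + (1 - v) *: P ly) /P !scalerDr !scalerA addrACA.
    by rewrite -!scalerDl; congr (_ *: _ + _ *: _); ring.
  rewrite !phiE -[leRHS]/(v * phi lx + (1 - v) * phi ly).
  (* Convexity: the subgradient inequalities at the barycentre [w] are averaged, and their slope
     terms cancel. *)
  set w := v * lx + _; have [s sP] := sub w.
  have hx := ler_wpM2l v0 (sP lx).
  have v1' : 0 <= 1 - v by rewrite subr_ge0.
  have hy := ler_wpM2l v1' (sP ly).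
  have w0 : v * (lx - w) + (1 - v) * (ly - w) = 0 by rewrite /w; ring.
  have ws : v * ((lx - w) * s) + (1 - v) * ((ly - w) * s) = 0.
    by rewrite !mulrA -mulrDl w0 mul0r.
  lra.
suff [m mP] : exists m, forall t, phi m <= phi t.
  by exists (P m) => // p /PL[l ->]; rewrite !phiE.
have [q0|q0] := eqVneq q 0.
  by exists 0 => t; rewrite /phi q0 !scaler0.
have [s0 [a [K [a0 H]]]] := pencil_span_bounds hn q0 hyp.
have coer t : a * `|t| - K <= phi t by have [_] := H t.
exact: subgradient_coercive_min a0 sub coer.
Qed.
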